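(* Let $X$ be a set. No functional extension of $X$ satisfies at once the three principles Ind, Poss, and Tran.
   Context: Convention: $X$ is a set with two distinct distinguished elements $0,1\in X$; characteristic functions take values in $\{0,1\}$, and so are regarded as functions into $X$ (or into a superset of $X$). Functional extension: a functional extension of $X$ is a proper superset ${}^{*}X\supsetneq X$ together with, for each function $f:X\to X$, a distinguished extension ${}^{*}f:{}^{*}X\to{}^{*}X$ of $f$ (so ${}^{*}f(x)=f(x)$ for $x\in X$), such that: (comp) ${}^{*}(g\circ f)={}^{*}g\circ{}^{*}f$ for all $f,g:X\to X$; (equ) ${}^{*}(\chi_{fg})=\chi_{{}^{*}f\,{}^{*}g}$ for all $f,g:X\to X$, where for two functions $\phi,\psi$ with common domain, $\chi_{\phi\psi}(z)=1$ if $\phi(z)=\psi(z)$ and $\chi_{\phi\psi}(z)=0$ otherwise; (dir) for all $\xi,\eta\in{}^{*}X$ there exist $p_1,p_2:X\to X$ and $\zeta\in{}^{*}X$ such that $\xi={}^{*}p_1(\zeta)$ and $\eta={}^{*}p_2(\zeta)$. Extension of $n$-ary functions and relations in a functional extension: for all $\xi_1,\dots,\xi_n\in{}^{*}X$ there exist $p_1,\dots,p_n:X\to X$ and $\zeta\in{}^{*}X$ with ${}^{*}p_i(\zeta)=\xi_i$. For $F:X^n\to X$ one sets ${}^{*}F(\xi_1,\dots,\xi_n)={}^{*}(F\circ(p_1,\dots,p_n))(\zeta)$, which is independent of the choice of the $p_i$ and $\zeta$. For an $n$-ary relation $R\subseteq X^n$ with characteristic function $\chi_R:X^n\to X$, one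 sets ${}^{*}R=\{(\xi_1,\dots,\xi_n)\in({}^{*}X)^n\mid{}^{*}\chi_R(\xi_1,\dots,\xi_n)=1\}$. In particular, for $A\subseteq X$, ${}^{*}A=\{\xi\in{}^{*}X\mid{}^{*}\chi_A(\xi)=1\}$. Ind: different elements of ${}^{*}X$ are separated by the extension of some property of $X$, i.e. for all $\xi\neq\eta$ in ${}^{*}X$ there exists $A\subseteq X$ with $\xi\in{}^{*}A$ and $\eta\notin{}^{*}A$. Poss: for every family $\mathcal{F}$ of subsets of $X$ with the finite intersection property, $\bigcap_{A\in\mathcal{F}}{}^{*}A\neq\emptyset$. Tran: for every first-order sentence $\varphi$ in the language having a symbol for each element of $X$, each finitary function $X^n\to X$ and each finitary relation on $X$, $\varphi$ is true in $X$ if and only if it is true in ${}^{*}X$ when each element of $X$ is interpreted as itself, each function $F$ as ${}^{*}F$ and each relation $R$ as ${}^{*}R$. *)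

(* Defs.v *)
From mathcomp Require Import all_boot.
From mathcomp Require Import boolp classical_sets functions cardinality.

Set Implicit Arguments.
Unset Strict Implicit.
Unset Printing Implicit Defensive.

Local Open Scope classical_set_scope.

Section CharacteristicFunctions.
Variables (S : Type) (zero one : S).

Definition chi_set (T : Type) (A : set T) : T -> S :=
  fun x => if `[< A x >] then one else zero.

Definition chi_eq (T U : Type) (phi psi : T -> U) : T -> S :=
  fun z => if `[< phi z = psi z >] then one else zero.

End CharacteristicFunctions.

(* The distinguished elements 0 and 1 of X are the parameters [zero] and      *)
(* [one]; their distinctness is a hypothesis of the results using it. The     *)
(* inclusion of X into its proper superset is an injective, non-surjective    *)
(* map [inj], so on the superset characteristic functions take the values     *)
(* [inj zero] and [inj one].                                                  *)
Record functional_extension (X : Type) (zero one : X) := FunctionalExtension {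
  ext :> Type;
  inj : X -> ext;
  inj_injective : injective inj;
  inj_proper : exists xi : ext, forall x : X, inj x <> xi;
  star : (X -> X) -> ext -> ext;
  star_extends : forall (f : X -> X) (x : X), star f (inj x) = inj (f x);
  star_comp : forall f g : X -> X, star (g \o f) = star g \o star f;
  star_equ : forall f g : X -> X,
    star (chi_eq zero one f g) =
    chi_eq (inj zero) (inj one) (star f) (star g);
  star_dir : forall xi eta : ext, exists (p1 p2 : X -> X) (zeta : ext),
    xi = star p1 zeta /\ eta = star p2 zeta
}.

Arguments ext {X zero one} E : rename.
Arguments inj {X zero one} E x : rename.
Arguments star {X zero one} E f xi : rename.

Section FunctionalExtensions.
Variables (X : Type) (zero one : X) (E : functional_extension zero one).

Lemma star_dir_nary (n : nat) (xi : 'I_n -> E) :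
  exists w : ('I_n -> X -> X) * E, forall i, star E (w.1 i) w.2 = xi i.
Proof.
elim: n xi => [|n IHn] xi.
  by exists (fun=> id, inj E zero) => -[].
have [[p z] /= pz] := IHn (fun i => xi (lift ord0 i)).
have [q1 [q2 [z' [e0 ez]]]] := star_dir (xi ord0) z.
exists (fun i => if unlift ord0 i is Some j then p j \o q2 else q1, z') => i /=.
case: unliftP => [j|] -> //=.
by rewrite star_comp /= -ez pz.
Qed.

(* The choice of the [p_i] and [zeta] is irrelevant, see [star_funE].         *)
Definition star_fun (n : nat) (F : ('I_n -> X) -> X) (xi : 'I_n -> E) : E :=
  let w := sval (cid (star_dir_nary xi)) in
  star E (fun x => F (fun i => w.1 i x)) w.2.

Definition star_rel (n : nat) (R : set ('I_n -> X)) : set ('I_n -> E) :=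
  [set xi | star_fun (chi_set zero one R) xi = inj E one].

Definition star_set (A : set X) : set E :=
  [set xi | star E (chi_set zero one A) xi = inj E one].

Hypothesis zero_neq_one : zero <> one.

Lemma star_cst (x : X) (xi : E) : star E (fun=> x) xi = inj E x.
Proof.
have cst1 : star E (fun=> one) xi = inj E one.
  have -> : (fun=> one) = chi_eq zero one (@id X) id.
    by apply/funext => z; rewrite /chi_eq asboolT.
  by rewrite star_equ /chi_eq asboolT.
have -> : (fun=> x) = (fun=> x) \o (fun=> one) :> (X -> X) by [].
by rewrite star_comp /= cst1 star_extends.
Qed.

Lemma star_eqP (f g : X -> X) (xi : E) :
  star_set [set x | f x = g x] xi <-> star E f xi = star E g xi.
Proof.
rewrite /star_set /= -[chi_set _ _ _]/(chi_eq zero one f g) star_equ /chi_eq.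
case: asboolP => h; split=> // /(@inj_injective _ _ _ E) e.
by case: zero_neq_one.
Qed.

Lemma star_local (A : set X) (f g : X -> X) (xi : E) :
  star_set A xi -> (forall x, A x -> f x = g x) -> star E f xi = star E g xi.
Proof.
move=> Axi fg.
have [[a Aa]|A0] := pselect (exists a, A a); last first.
  move: Axi; rewrite /star_set /=.
  have -> : chi_set zero one A = fun=> zero.
    by apply/funext => x; rewrite /chi_set asboolF // => Ax; apply: A0; exists x.
  by rewrite star_cst => /(@inj_injective _ _ _ E).
pose e x := if `[< A x >] then x else a.
have eA : A = [set x | e x = x].
  apply/seteqP; split=> x /=; rewrite /e; first by move=> ?; rewrite asboolT.
  by case: asboolP => // _ <-.
have /esym xiE : star E e xi = xi.
  move: Axi; rewrite eA => /(star_eqP e id) ->.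
  have [p1 [_ [z [-> _]]]] := star_dir xi xi.
  by rewrite -[LHS]/((star E id \o star E p1) z) -star_comp.
have fe : f \o e = g \o e.
  by apply/funext => x /=; apply: fg; rewrite /e; case: asboolP.
by rewrite xiE -[LHS]/((star E f \o star E e) xi) -star_comp fe star_comp.
Qed.

Lemma star_setI (A B : set X) (xi : E) :
  star_set A xi -> star_set B xi -> star_set (A `&` B) xi.
Proof.
move=> Axi; rewrite /star_set /= => <-; apply: (star_local Axi) => x Ax.
by rewrite /chi_set; congr (if _ then _ else _); apply/asboolP/asboolP=> [[]|].
Qed.

Lemma star_set_forall (n : nat) (A : 'I_n -> set X) (xi : E) :
  (forall i, star_set (A i) xi) -> star_set [set x | forall i, A i x] xi.
Proof.
elim: n A => [|n IHn] A Axi.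
  have -> : [set x | forall i : 'I_0, A i x] = [set x : X | x = x].
    by apply/seteqP; split=> x //= _ [].
  exact/(star_eqP id id).
have -> : [set x | forall i, A i x] =
    A ord0 `&` [set x | forall i, A (lift ord0 i) x].
  apply/seteqP; split=> x /=; first by move=> Ax; split.
  by move=> [A0 Ax] i; case: (unliftP ord0 i) => [j|] ->.
by apply: star_setI => //; apply: IHn.
Qed.

Lemma star_funE (n : nat) (F : ('I_n -> X) -> X) (p : 'I_n -> X -> X)
    (zeta : E) :
  star_fun F (fun i => star E (p i) zeta) =
  star E (fun x => F (fun i => p i x)) zeta.
Proof.
rewrite /star_fun; case: cid => -[q z] /= qz.
have [r [s [mu [zE zetaE]]]] := star_dir z zeta.
rewrite zE zetaE -[LHS]/((star E _ \o star E r) mu).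
rewrite -[RHS]/((star E _ \o star E s) mu) -!star_comp.
apply: (@star_local [set x | forall i, q i (r x) = p i (s x)]).
  apply: star_set_forall => i; apply/(star_eqP (q i \o r) (p i \o s)).
  by rewrite (star_comp E r) (star_comp E s) /= -zE -zetaE.
by move=> x /= qp; congr F; apply/funext.
Qed.

End FunctionalExtensions.

(* First-order logic with equality, over the language having a symbol for     *)
(* each element of X and each finitary function and relation on X; variables  *)
(* are named by natural numbers.                                              *)
Section FirstOrderLogic.
Variable X : Type.

Inductive term : Type :=
| Var of nat
| Elt of X
| App (n : nat) (F : ('I_n -> X) -> X) (t : 'I_n -> term).

Inductive formula : Type :=
| Equal of term & term
| Rel (n : nat) (R : set ('I_n -> X)) (t : 'I_n -> term)
| Neg of formula
| Conj of formula & formula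
| Disj of formula & formula
| Impl of formula & formula
| Forall of nat & formula
| Exists of nat & formula.

Fixpoint var_in (k : nat) (t : term) : Prop :=
  match t with
  | Var m => k = m
  | Elt _ => False
  | App n _ ts => exists i : 'I_n, var_in k (ts i)
  end.

Fixpoint free_in (k : nat) (phi : formula) : Prop :=
  match phi with
  | Equal t u => var_in k t \/ var_in k u
  | Rel n _ ts => exists i : 'I_n, var_in k (ts i)
  | Neg psi => free_in k psi
  | Conj psi chi | Disj psi chi | Impl psi chi => free_in k psi \/ free_in k chi
  | Forall m psi | Exists m psi => k <> m /\ free_in k psi
  end.

Definition sentence (phi : formula) : Prop := forall k, ~ free_in k phi.

Record structure := Structure {
  domain :> Type;
  elt_interp : X -> domain;
  fun_interp : forall n, (('I_n -> X) -> X) -> ('I_n -> domain) -> domain;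
  rel_interp : forall n, set ('I_n -> X) -> set ('I_n -> domain)
}.

Section Semantics.
Variable M : structure.

Fixpoint eval (v : nat -> M) (t : term) : M :=
  match t with
  | Var m => v m
  | Elt x => elt_interp M x
  | App n F ts => fun_interp F (fun i => eval v (ts i))
  end.

Definition update (v : nat -> M) (k : nat) (a : M) : nat -> M :=
  fun m => if m == k then a else v m.

Fixpoint holds (v : nat -> M) (phi : formula) : Prop :=
  match phi with
  | Equal t u => eval v t = eval v u
  | Rel n R ts => rel_interp (s := M) R (fun i => eval v (ts i))
  | Neg psi => ~ holds v psi
  | Conj psi chi => holds v psi /\ holds v chi
  | Disj psi chi => holds v psi \/ holds v chi
  | Impl psi chi => holds v psi -> holds v chi
  | Forall k psi => forall a : M, holds (update v k a) psi
  | Exists k psi => exists a : M, holds (update v k a) psi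
  end.

(* For a sentence in a nonempty structure the valuation is irrelevant.        *)
Definition true_in (phi : formula) : Prop := forall v, holds v phi.

End Semantics.

Definition base_structure : structure :=
  @Structure X id (fun _ F => F) (fun _ R => R).

End FirstOrderLogic.

Section Principles.
Variables (X : Type) (zero one : X) (E : functional_extension zero one).

Definition star_structure : structure X :=
  @Structure X E (inj E) (@star_fun X zero one E) (@star_rel X zero one E).

Definition Ind : Prop :=
  forall xi eta : E, xi <> eta ->
    exists A : set X, star_set A xi /\ ~ star_set A eta.

Definition finite_intersection_property (F : set (set X)) : Prop :=
  forall G : set (set X), G `<=` F -> finite_set G ->
    \bigcap_(A in G) A !=set0.

Definition Poss : Prop :=
  forall F : set (set X), finite_intersection_property F ->
    \bigcap_(A in F) star_set (E := E) A !=set0.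

Definition Tran : Prop :=
  forall phi : formula X, sentence phi ->
    (true_in (base_structure X) phi <-> true_in star_structure phi).

End Principles.

(* Main.v *)
(* By Poss, every ultrafilter on X is the type {A | xi in *A} of some point   *)
(* xi, and by Ind this point is unique. Take the type U of a point xi         *)
(* containing all the tails of an injective sequence in X (X is infinite,     *)
(* since *X is a proper extension), and p1, p2 : X -> X whose values          *)
(* (p1 z, p2 z) run through all pairs of terms of the sequence. The sets      *)
(* p1^-1(A), p2^-1(A) for A in U and {z | p1 z <> p2 z} have the finite       *)
(* intersection property, so by Poss some zeta lies in all their extensions.  *)
(* Ind then gives *p1(zeta) = xi = *p2(zeta), so zeta is in *{p1 = p2} as     *)
(* well as in *{p1 <> p2}, which is absurd.                                   *)

From mathcomp Require Import all_boot.
From mathcomp Require Import boolp classical_sets functions cardinality.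
Require Import Defs.

Set Implicit Arguments.
Unset Strict Implicit.
Unset Printing Implicit Defensive.

Local Open Scope classical_set_scope.

(** [Poss] supplies too many points for [Ind]: off the diagonal, a pair can have both coordinates of
    type U. [star_setI], [star_setC] and [star_setN0] make U an ultrafilter; [infinite_base]
    provides the sequence. *)

Lemma finite_intersection_property_filter (X : Type) (F : set (set X)) :
  F setT -> (forall A B, F A -> F B -> F (A `&` B)) ->
  (forall A, F A -> A !=set0) -> finite_intersection_property F.
Proof.
move=> FT FI Fn0 G GF /(@finite_seqP {classic set X})[s Gs].
suff [B FB BG] : exists2 B, F B & forall A, A \in s -> B `<=` A.
  have [x Bx] := Fn0 _ FB; exists x => A GA; apply: (BG A) => //.
  by move: GA; rewrite Gs.
have {GF Gs} : forall A, A \in s -> F A.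
  by move=> A As; apply: GF; rewrite Gs.
elim: s => [|A s IHs] sF; first by exists setT.
have [B FB Bs] := IHs (fun C Cs => sF C (mem_behead (s := A :: s) Cs)).
exists (A `&` B); first by apply: FI => //; apply: sF; exact: mem_head.
by move=> C; rewrite inE => /predU1P[->|/Bs BC] x [] // _ /BC.
Qed.

Lemma infinite_type_sequence (X : Type) :
  infinite_set [set: X] -> exists f : nat -> X, injective f.
Proof.
move=> /infiniteP/card_leP[f].
exists (fun n => \val (f (exist _ n (mem_set I)))) => m n /val_inj.
by move=> /(@functions.inj _ _ _ f) e; case: (e (mem_set I) (mem_set I)).
Qed.

Section StarSets.
Variables (X : Type) (zero one : X) (E : functional_extension zero one).
Hypothesis zero_neq_one : zero <> one.

Lemma star_id (xi : E) : star E id xi = xi.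
Proof.
have [p [_ [zeta [-> _]]]] := star_dir xi xi.
by rewrite -[LHS]/((star E id \o star E p) zeta) -star_comp.
Qed.

(** On an empty [A] the constants [zero] and [one] agree vacuously, so [star_local] would identify
    them. *)
Lemma star_setN0 (A : set X) (xi : E) : star_set A xi -> A !=set0.
Proof.
move=> Axi; apply: contrapT => A0; apply: zero_neq_one.
apply: (inj_injective (f0 := E)).
rewrite -(star_cst zero xi) -(star_cst one xi).
by apply: (star_local zero_neq_one Axi) => x Ax; case: A0; exists x.
Qed.

(** Writing the characteristic function as a [chi_eq] forces its extension to take only the values 0
    and 1. *)
Lemma star_setC (A : set X) (xi : E) : ~ star_set A xi -> star_set (~` A) xi.
Proof.
move=> nAxi.
have -> : ~` A = [set x | chi_set zero one A x = zero].
  apply/seteqP; split=> x /=; first by move=> nAx; rewrite /chi_set asboolF.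
  by rewrite /chi_set; case: asboolP => // _ /esym/zero_neq_one.
apply/(star_eqP zero_neq_one); rewrite star_cst.
have chiE :
    chi_set zero one A = chi_eq zero one (chi_set zero one A) (fun=> one).
  apply/funext => x; rewrite /chi_eq /chi_set.
  by case: asboolP => _; case: asboolP.
by rewrite chiE star_equ /chi_eq star_cst // asboolF.
Qed.

(** A new point avoids the extension of every singleton; if finitely many covered [X], it would lie
    in the extension of the empty set. *)
Lemma infinite_base : infinite_set [set: X].
Proof.
move=> /(@finite_seqP {classic X})[s sT].
have [xi xi_new] := inj_proper E.
pose A (i : 'I_(size s)) := [set x | x <> nth zero s i].
have : star_set [set x | forall i, A i x] xi.
  apply: (star_set_forall zero_neq_one) => i; apply: star_setC.
  move=> /(star_eqP zero_neq_one id (fun=> _)).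
  by rewrite star_id star_cst => /esym /xi_new.
move=> /star_setN0[x /= Ax].
have /(nthP (zero : {classic X}))[i si xE] : (x : {classic X}) \in s.
  by have : [set: X] x by []; rewrite sT.
exact: (Ax (Ordinal si)).
Qed.

End StarSets.

Theorem theorem2p5 (X : Type) (zero one : X) (zero_neq_one : zero <> one)
    (E : functional_extension zero one) :
  ~ (Ind E /\ Poss E /\ Tran E).
Proof.
move=> [ind [poss _]].
have [f f_inj] := infinite_type_sequence (infinite_base E zero_neq_one).
pose tails := [set A : set X | exists k, forall n, k <= n -> A (f n)].
have [xi xi_tails] : \bigcap_(A in tails) star_set (E := E) A !=set0.
  apply: poss; apply: finite_intersection_property_filter; first by exists 0.
  - move=> A B [k Ak] [l Bl]; exists (maxn k l) => n.
    by rewrite geq_max => /andP[/Ak ? /Bl].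
  - by move=> A [k Ak]; exists (f k); apply: Ak.
have two_terms A : star_set A xi ->
    exists m n, [/\ A (f m), A (f n) & f m <> f n].
  move=> Axi.
  (* [A] meets every tail, since both have [xi] in their extensions. *)
  have tail k : exists2 n, k <= n & A (f n).
    have : star_set (f @` [set n | k <= n]) xi.
      by apply: xi_tails; exists k => n kn; exists n.
    move=> /(star_setI zero_neq_one Axi)/(star_setN0 zero_neq_one).
    by move=> [x [Ax [n kn fnx]]]; exists n => //; rewrite fnx.
  have [m _ Am] := tail 0; have [n mn An] := tail m.+1.
  by exists m, n; split=> // /f_inj mnE; rewrite mnE ltnn in mn.
pose index x := xget 0 [set n | f n = x].
have indexK : cancel f index.
  move=> n; apply: f_inj.
  by rewrite /index; apply: (@xgetPex _ 0 [set m | f m = f n]); exists n.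
pose pair x : nat * nat := odflt (0, 0) (unpickle (index x)).
pose p1 x := f (pair x).1; pose p2 x := f (pair x).2.
have p12 m n : exists z, p1 z = f m /\ p2 z = f n.
  by exists (f (pickle (m, n))); rewrite /p1 /p2 /pair indexK pickleK.
(* Closing upwards puts the preimages under [p1] and [p2] and the set where they differ into one
   filter. *)
pose F := [set C | exists2 A, star_set A xi &
                     [set z | [/\ A (p1 z), A (p2 z) & p1 z <> p2 z]] `<=` C].
have [zeta zetaF] : \bigcap_(C in F) star_set (E := E) C !=set0.
  apply: poss; apply: finite_intersection_property_filter.
  - by exists setT => //; apply: xi_tails; exists 0.
  - move=> C D [A Axi AC] [B Bxi BD]; exists (A `&` B); first exact: star_setI.
    by move=> z [[A1 B1] [A2 B2] ne]; split; [apply: AC|apply: BD].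
  - move=> C [A /two_terms[m [n [Am An mn]]] AC].
    have [z [z1 z2]] := p12 m n.
    by exists z; apply: AC; rewrite /= z1 z2.
(* A set separating [xi] from [star E p zeta] would contradict [star_comp]. *)
have starp p : (forall A, star_set A xi -> star_set (p @^-1` A) zeta) ->
    star E p zeta = xi.
  move=> pA; apply: contrapT => /nesym/ind[A [/pA]].
  rewrite /star_set /= -[star E _ (star E p zeta)]/((_ \o star E p) zeta).
  by rewrite -star_comp.
have p1E : star E p1 zeta = xi.
  by apply: starp => A Axi; apply: zetaF; exists A => // z [].
have p2E : star E p2 zeta = xi.
  by apply: starp => A Axi; apply: zetaF; exists A => // z [].
have eq12 : star_set [set z | p1 z = p2 z] zeta.
  by apply/(star_eqP zero_neq_one); rewrite p1E p2E.
have ne12 : star_set [set z | p1 z <> p2 z] zeta.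
  by apply: zetaF; exists setT; [apply: xi_tails; exists 0|move=> z []].
by have [z []] := star_setN0 zero_neq_one (star_setI zero_neq_one eq12 ne12).
Qed.
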